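(* Let $N\ge 1$, $n\ge 2$, let $\Gamma=\{\pi_1,\ldots,\pi_n\}$ be a path of activation patterns $\pi_i\in\{0,1\}^N$ for which $\chi(\Gamma)$ is defined, and let $-\Gamma=\{\pi_n,\ldots,\pi_1\}$ be the reversed path. Then $\chi(\Gamma)=0$ if and only if $\chi(-\Gamma)=0$.
   Context: Let $\mathcal{H}^N=\{0,1\}^N$ be the binary hypercube, with Hamming distance $d_H(u,v)=|\{i : u_i\neq v_i\}|$ for $u,v\in\mathcal{H}^N$. Elements of $\mathcal{H}^N$ are called activation patterns. A path is a finite ordered sequence $\Gamma=\{\pi_1,\ldots,\pi_n\}$ of activation patterns $\pi_i\in\mathcal{H}^N$ (repetitions allowed). Put $$r_1(\Gamma)=\max_{1\le i\le n} d_H(\pi_i,\pi_1),\qquad r_2(\Gamma)=\sum_{i=1}^{n-1} d_H(\pi_i,\pi_{i+1}),$$ where $\pi_1$ denotes the first element of the path in question (so for $-\Gamma$ distances in $r_1$ are measured from $\pi_n$). The space folding measure is $\chi(\Gamma)=1-r_1(\Gamma)/r_2(\Gamma)$, defined when $r_2(\Gamma)>0$ (note $r_2(-\Gamma)=r_2(\Gamma)$). *)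

(* Defs.v *)
From mathcomp Require Import all_boot all_order all_algebra.

Set Implicit Arguments.
Unset Strict Implicit.
Unset Printing Implicit Defensive.

Import GRing.Theory Num.Theory.

Definition hypercube (N : nat) : finType := {ffun 'I_N -> bool}.

Definition hamming (N : nat) (u v : hypercube N) : nat :=
  #|[set i : 'I_N | u i != v i]|.

(* Default value for [nth] and [head]; it is only ever returned on the empty
   path, as all indices used below are in range. *)
Definition pattern0 (N : nat) : hypercube N := [ffun=> false].

Definition r1 (N : nat) (G : seq (hypercube N)) : nat :=
  \max_(p <- G) hamming p (head (pattern0 N) G).

(* Patterns are numbered from 0, so the n - 1 consecutive pairs are (i, i + 1)
   for 0 <= i < n - 1. *)
Definition r2 (N : nat) (G : seq (hypercube N)) : nat :=
  \sum_(0 <= i < (size G).-1)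
     hamming (nth (pattern0 N) G i) (nth (pattern0 N) G i.+1).

(* The measure is a quotient of integers, hence rational. It is meaningful only
   when 0 < r2 G; otherwise the division by 0 makes it the junk value 1. *)
Definition chi (N : nat) (G : seq (hypercube N)) : rat :=
  (1 - (r1 G)%:R / (r2 G)%:R)%R.

(* Main.v *)
Require Import Defs.
From mathcomp Require Import all_boot all_order all_algebra.
From mathcomp Require Import zify.

(** Let [D] be the distance between the two endpoints of the path. A pattern
    [p] of the path splits it into two parts, so [d(p, first) + d(p, last)] is
    at most [r2]; with the triangle inequality this gives
    [2 d(p, first) <= r2 + D], hence [2 r1 <= r2 + D]. As [D <= r1 <= r2], the
    measure vanishes exactly when [D = r2], and both [D] and [r2] are invariant
    under reversal. *)

Import GRing.Theory Num.Theory.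

Lemma hamming_sym N (u v : hypercube N) : hamming u v = hamming v u.
Proof. by apply: eq_card => i; rewrite !inE eq_sym. Qed.

Lemma hamming_refl N (u : hypercube N) : hamming u u = 0.
Proof. by apply: eq_card0 => i; rewrite !inE eqxx. Qed.

(** A coordinate where [v] agrees with both [u] and [w] is one where [u] and [w] agree, so the
    disagreement set of [u] and [w] lies in the union of the other two. *)
Lemma hamming_triangle N (u v w : hypercube N) :
  hamming u w <= hamming u v + hamming v w.
Proof.
apply: leq_trans (leq_card_setU _ _); apply/subset_leq_card/subsetP => i.
by rewrite !inE; apply: contraR; rewrite negb_or !negbK => /andP[/eqP-> /eqP->].
Qed.

Lemma hamming_le_length N (f : nat -> hypercube N) i j :
  i <= j -> hamming (f i) (f j) <= \sum_(i <= k < j) hamming (f k) (f k.+1).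
Proof.
elim: j => [|j IHj]; first by rewrite leqn0 => /eqP->; rewrite hamming_refl.
rewrite leq_eqVlt => /predU1P[->|]; first by rewrite hamming_refl.
rewrite ltnS => le_ij; rewrite big_nat_recr //=.
by rewrite (leq_trans (hamming_triangle _ _ (f j) _)) // leq_add2r IHj.
Qed.

Definition endpoint_distance N (G : seq (hypercube N)) : nat :=
  hamming (last (pattern0 N) G) (head (pattern0 N) G).

Lemma endpoint_distance_rev N (G : seq (hypercube N)) :
  endpoint_distance N (rev G) = endpoint_distance N G.
Proof.
rewrite /endpoint_distance hamming_sym -!nth_last -!nth0 size_rev.
by case: G => [//|x s]; rewrite !nth_rev ?subnn ?subn1.
Qed.

(** With [n] patterns numbered from 0, step [i] of the reversed path is step [n - 2 - i] of [G]
    walked backwards. *)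
Lemma r2_rev N (G : seq (hypercube N)) : r2 (rev G) = r2 G.
Proof.
rewrite /r2 size_rev [RHS]big_nat_rev /=; apply: eq_big_nat => i lt_i.
rewrite hamming_sym !nth_rev; [|lia|lia].
by congr (hamming (nth _ _ _) (nth _ _ _)); lia.
Qed.

Lemma hamming_ends_le_r2 N (G : seq (hypercube N)) p : p \in G ->
  hamming p (head (pattern0 N) G) + hamming p (last (pattern0 N) G) <= r2 G.
Proof.
move=> Gp; have le_p : index p G <= (size G).-1.
  by have := Gp; rewrite -index_mem; case: (size G).
(* The sum is cut at the first occurrence of [p]; each half is the length of a subpath that joins
   [p] to an endpoint. *)
rewrite /r2 (big_cat_nat (n := index p G)) //= -nth_last -nth0 hamming_sym.
have len i j := hamming_le_length N (nth (pattern0 N) G) i j.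
have len_l := len _ _ (leq0n (index p G)); have len_r := len _ _ le_p.
by rewrite nth_index // in len_l len_r; apply: leq_add.
Qed.

Lemma r1_le_r2 N (G : seq (hypercube N)) : r1 G <= r2 G.
Proof.
apply/bigmax_leqP_seq => p Gp _.
exact: leq_trans (leq_addr _ _) (hamming_ends_le_r2 N G p Gp).
Qed.

Lemma double_r1_le N (G : seq (hypercube N)) :
  (r1 G).*2 <= r2 G + endpoint_distance N G.
Proof.
(* The factor 2 moves to the right so that the maximum can be bounded term by term; rounding down
   loses nothing, as [r1 G] is an integer. *)
suff : r1 G <= (r2 G + endpoint_distance N G)./2 by lia.
apply/bigmax_leqP_seq => p Gp _.
have := hamming_ends_le_r2 N G p Gp.
have := hamming_triangle N p (last (pattern0 N) G) (head (pattern0 N) G).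
rewrite -/(endpoint_distance N G); lia.
Qed.

Lemma endpoint_distance_le_r1 N (G : seq (hypercube N)) :
  endpoint_distance N G <= r1 G.
Proof.
case: G => [|x s]; first by rewrite /endpoint_distance hamming_refl.
(* The last pattern is itself a candidate in the maximum. *)
exact: (leq_bigmax_seq (F := fun p => hamming p x) _ (mem_last x s)).
Qed.

Lemma r1_eq_r2 N (G : seq (hypercube N)) :
  (r1 G == r2 G) = (endpoint_distance N G == r2 G).
Proof.
have := r1_le_r2 N G; have := double_r1_le N G.
have := endpoint_distance_le_r1 N G; lia.
Qed.

Lemma chi_eq0 N (G : seq (hypercube N)) : 0 < r2 G ->
  (chi G == 0%R) = (endpoint_distance N G == r2 G).
Proof.
move=> r2_gt0; have r2_neq0 : ((r2 G)%:R != 0 :> rat)%R.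
  by rewrite pnatr_eq0 -lt0n.
rewrite -r1_eq_r2 /chi subr_eq0 eq_sym.
(* Multiplication by the nonzero [r2 G] clears the denominator and leaves an equality of
   naturals. *)
by rewrite -(inj_eq (mulIf r2_neq0)) divfK // mul1r eqr_nat.
Qed.

Theorem corollary4p4 (N n : nat) (hN : (1 <= N)%N) (hn : (2 <= n)%N)
    (Gamma : n.-tuple (hypercube N)) (hdef : (0 < r2 Gamma)%N) :
  chi Gamma = 0%R <-> chi (rev Gamma) = 0%R.
Proof.
suff eq_chi : (chi Gamma == 0%R) = (chi (rev Gamma) == 0%R).
  by split=> /eqP; [rewrite eq_chi | rewrite -eq_chi] => /eqP.
by rewrite !chi_eq0 ?endpoint_distance_rev ?r2_rev.
Qed.
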